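(* Let $F:\mathbb{R}^T\times\mathbb{R}\to\mathbb{R}^T$ be sufficiently differentiable, and let $\bm{x}=\bm{x}(\beta)$ be a function, defined and sufficiently many times differentiable in a neighborhood of $\beta_0\in\mathbb{R}$, which is a root of $F$: $F(\bm{x}(\beta),\beta)=\bm{0}$ for all $\beta$ in that neighborhood. All derivatives below are evaluated at $(\bm{x}(\beta_0),\beta_0)$. Let $l>1$, and suppose that the derivatives $\frac{d^k\bm{x}}{d\beta^k}$ are known for all $0<k<l$. Then $$D_{\bm{x}}F\Big[\tfrac{d^l\bm{x}}{d\beta^l}\Big]=-\sum_{\substack{\text{non-trivial}\\ \text{partitions of } l}}\ \sum_{b=0}^{m_1\cdot\delta(p_1=1)}\frac{l!}{b!\,(m_1-b)!\,m_2!\cdots m_s!\,(p_1!)^{m_1}\cdots(p_s!)^{m_s}}\cdot D^m_{\beta^b,\bm{x}^{m-b}}F\Big[\big(\tfrac{d^{p_1}\bm{x}}{d\beta^{p_1}}\big)_{\times(m_1-b)},\big(\tfrac{d^{p_2}\bm{x}}{d\beta^{p_2}}\big)_{\times m_2},\dots,\big(\tfrac{d^{p_s}\bm{x}}{d\beta^{p_s}}\big)_{\times m_s}\Big],$$ where the outer sum is over the non-trivial integer partitions $(m_1)\cdot p_1+\dots+(m_s)\cdot p_s$ of $l$, $m:=m_1+\dots+m_s$, and the $l$-th order derivative $\frac{d^l\bm{x}}{d\beta^l}$ appears only at the left-hand side (the right-hand side involves only $\frac{d^k\bm{x}}{d\beta^k}$ with $0<k<l$). For $l=1$, one has instead $D_{\bm{x}}F\big[\frac{d\bm{x}}{d\beta}\big]=-D_\beta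 F$.
   Context: Derivative tensors: for integers $b,m\ge 0$ and $F=(F_1,\dots,F_T)$, $D^{b+m}_{\beta^b,\bm{x}^m}F$ is the vector-valued symmetric $m$-multilinear map whose $i$-th coordinate on $\bm{v}_1,\dots,\bm{v}_m\in\mathbb{R}^T$ is $\sum_{1\le i_1,\dots,i_m\le T}v_{1,i_1}\cdots v_{m,i_m}\frac{\partial^m}{\partial x_{i_1}\cdots\partial x_{i_m}}\frac{\partial^b F_i}{\partial\beta^b}$. In particular $D_{\bm{x}}F$ is the Jacobian matrix in $\bm{x}$ and $D_\beta F$ the vector of partial $\beta$-derivatives. The notation $(\bm{v})_{\times k}$ means that the argument $\bm{v}$ is repeated $k$ times. Partitions: a partition of $l$ is written $(m_1)\cdot p_1+\dots+(m_s)\cdot p_s$ with distinct parts $0<p_1<\dots<p_s$ of multiplicities $m_1,\dots,m_s\ge1$ and $\sum_i m_ip_i=l$; the trivial partition is $(1)\cdot l$. The symbol $\delta(p_1=1)$ is $1$ if $p_1=1$ and $0$ otherwise. *)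

(* Defs.v *)
From HB Require Import structures.
From mathcomp Require Import all_boot all_order all_algebra.
From mathcomp Require Import all_classical all_reals all_analysis.

Set Implicit Arguments.
Unset Strict Implicit.
Unset Printing Implicit Defensive.

Import Order.TTheory GRing.Theory Num.Theory.
Import numFieldNormedType.Exports.

Local Open Scope classical_set_scope.
Local Open Scope ring_scope.

(* [f] is [n] times differentiable on the whole space, in the sense of Frechet.
   For finite-dimensional [V], the differential [V -> L(V, W)] is [n] times
   differentiable iff its evaluation at each vector [v], which is ['D_v f],
   is. *)
Fixpoint times_differentiable {R : realType} {V W : normedModType R}
    (n : nat) (f : V -> W) : Prop :=
  if n is k.+1 then
    (forall p : V, differentiable f p) /\
    (forall v : V, times_differentiable k ('D_v f))
  else True.

Section DerivativeTensor.
Context {R : realType} {T : nat}.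
Implicit Types (g : 'rV[R]_T * R -> R) (F : 'rV[R]_T * R -> 'rV[R]_T).

Definition partial_x (i : 'I_T) g : 'rV[R]_T * R -> R :=
  'D_((delta_mx 0 i, 0) : 'rV[R]_T * R) g.

Definition partial_beta g : 'rV[R]_T * R -> R :=
  'D_((0, 1) : 'rV[R]_T * R) g.

(* [derivative_tensor F b [:: v_1; ...; v_m] p] is
   D^(b+m)_(beta^b, x^m) F [v_1, ..., v_m] evaluated at [p]; the order [m] in
   [x] is the number of arguments. *)
Definition derivative_tensor F (b : nat) (vs : seq 'rV[R]_T)
    (p : 'rV[R]_T * R) : 'rV[R]_T :=
  \row_(i < T) \sum_(js : (size vs).-tuple 'I_T)
    (\prod_(k < size vs) vs`_k 0 (tnth js k)) *
    foldr partial_x (iter b partial_beta (fun q => F q 0 i)) js p.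

End DerivativeTensor.

(* The partition (m_1).p_1 + ... + (m_s).p_s, with p_1 < ... < p_s, is
   represented by the sequence of pairs [:: (m_1, p_1); ...; (m_s, p_s)]. *)
Definition is_partition (l : nat) (lam : seq (nat * nat)) : bool :=
  [&& sorted ltn [seq q.2 | q <- lam],
      all (fun q => (0 < q.1)%N && (0 < q.2)%N) lam
    & (\sum_(q <- lam) q.1 * q.2 == l)%N].

Definition nontrivial_partitions (l : nat) : set (seq (nat * nat)) :=
  [set lam | is_partition l lam /\ lam <> [:: (1%N, l)]].

Definition first_mult (lam : seq (nat * nat)) : nat := (head (0, 0)%N lam).1.
Definition first_part (lam : seq (nat * nat)) : nat := (head (0, 0)%N lam).2.

Definition partition_coef (R : realType) (l : nat) (lam : seq (nat * nat))
    (b : nat) : R :=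
  l`!%:R /
  (b`! * (first_mult lam - b)`! * (\prod_(q <- behead lam) q.1`!) *
   \prod_(q <- lam) q.2`! ^ q.1)%N%:R.

Definition partition_args (V : Type) (xd : nat -> V) (lam : seq (nat * nat))
    (b : nat) : seq V :=
  nseq (first_mult lam - b) (xd (first_part lam)) ++
  flatten [seq nseq q.1 (xd q.2) | q <- behead lam].

(* The sum over [nontrivial_partitions l] below is a finitely supported sum,
   which would be 0 by convention on an infinite support. *)
Lemma finite_nontrivial_partitions (l : nat) :
  finite_set (nontrivial_partitions l).
Proof.
pose A := [set s : seq ('I_l.+1 * 'I_l.+1) | (size s < l.+1)%N].
pose f (s : seq ('I_l.+1 * 'I_l.+1)) : seq (nat * nat) :=
  [seq (val q.1, val q.2) | q : ('I_l.+1 * 'I_l.+1)%type <- s].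
have fA : finite_set A.
  have -> : A = \bigcup_(n in `I_l.+1)
      range (@tval n ('I_l.+1 * 'I_l.+1)%type).
    apply/seteqP; split => [s ls|s [n /= ln [t _ <-]]].
      by exists (size s) => //; exists (in_tuple s).
    by rewrite /A /= size_tuple.
  apply: bigcup_finite => [|n _]; first exact: finite_II.
  exact/finite_image/finite_finset.
apply: (@sub_finite_set _ _ (f @` A)); last exact: finite_image.
move=> lam [/and3P[_ /allP pos /eqP sum_pi] _].
have le1 q : q \in lam -> (q.1 * q.2 <= l)%N.
  by move=> qpi; rewrite -sum_pi (big_rem q) //= leq_addr.
exists [seq (inord q.1, inord q.2) | q <- lam].
  rewrite /A /= size_map ltnS -sum_pi -sum1_size big_seq [leqRHS]big_seq.
  by apply: leq_sum => q /pos /andP[a b]; rewrite muln_gt0 a b.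
rewrite /f -map_comp -[RHS]map_id; apply/eq_in_map => -[m p] q /=.
have /andP[/= m0 p0] := pos _ q; have /= mpl := le1 _ q.
rewrite !inordK //= ltnS; apply: leq_trans mpl.
  by rewrite leq_pmull.
by rewrite leq_pmulr.
Qed.

(* Main.v *)
(* Along the curve z(beta) = (x(beta), beta), the chain and Leibniz rules give,
   for scalar f,
     (f o z)^(n+1) = sum_k 'C(n,k) (D_(x^(k+1),0) f o z)^(n-k)
                     + (D_beta f o z)^(n),
   where D_v is the derivative in the fixed direction v.  Since the D_v commute
   (Schwarz), this is the recursion of the Bell polynomials in the "variables"
   D_beta (of weight 1) and D_(x^(k),0) (of weight k), and Euler's identity for
   weighted homogeneous polynomials solves it:
     (f o z)^(l) = l! sum_mu prod_i D_(w_i)^mu_i / (mu_i! (p_i!)^mu_i) f,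
   over the multi-indices mu of weight l.  A multi-index amounts to a partition
   of l together with the number b <= m_1 of parts 1 taken in the direction
   beta, and (f o z)^(l) = 0 when f is a coordinate of F. *)
Require Import Defs.
From mathcomp Require Import all_boot all_order all_algebra.
From mathcomp Require Import all_classical all_reals all_analysis.
From mathcomp Require Import ring lra.
Import Order.TTheory GRing.Theory Num.Theory.
Import numFieldNormedType.Exports.
Local Open Scope ring_scope.
Local Open Scope classical_set_scope.

(** * Schwarz's theorem for directional derivatives *)

Section MixedPartials.
Context {R : realType} {V : normedModType R}.
Implicit Types (f : V -> R) (p u v w : V).

Lemma is_derive_line f p w (s : R) : derivable f (p + s *: w) w ->
  is_derive s 1 (fun r : R => f (p + r *: w)) ('D_w f (p + s *: w)).
Proof.
move=> df.
have E : (fun h : R => h^-1 *: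
     (((fun r : R => f (p + r *: w)) \o shift s) (h *: 1) - f (p + s *: w))) =
   (fun h : R => h^-1 *: ((f \o shift (p + s *: w)) (h *: w) - f (p + s *: w))).
  apply/funext => h /=; congr (_ *: (f _ - _)).
  by rewrite [h *: 1]mulr1 scalerDl addrCA.
by split; [rewrite /derivable E | rewrite /derive E].
Qed.

Lemma differentiable_bound f p : differentiable f p -> forall e : R, 0 < e ->
  exists2 d : R, 0 < d &
    forall w, `|w| < d -> `|f (p + w) - f p - 'd f p w| <= e * `|w|.
Proof.
move=> df e e0.
have /eqaddoP/(_ _ e0) := diff_locally df.
rewrite near_simpl => /nbhs_norm0P[d /= d0 H]; exists d => // w wd.
have /= := H w wd; rewrite !fctE /= (addrC w p) opprD addrA.
by [].
Qed.

(** Alternating sum of [f] over the corners of the parallelogram at [p] with sides [t *: u] and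
    [t *: v]; its quotient by [t ^+ 2] approximates the mixed derivative. *)
Definition second_difference f p u v (t : R) :=
  f (p + t *: u + t *: v) - f (p + t *: u) - f (p + t *: v) + f p.

Lemma second_difference_sym f p u v t :
  second_difference f p u v t = second_difference f p v u t.
Proof. by rewrite /second_difference [p + _ + _]addrAC; ring. Qed.

(* MVT on [s |-> f (p + t v + s t u) - f (p + s t u)], then the expansion of
   ['D_u f] at [p]. *)
Lemma second_difference_approx f p u v :
  (forall q, differentiable f q) -> differentiable ('D_u f) p ->
  forall e : R, 0 < e -> exists2 d : R, 0 < d & forall t : R, 0 < t < d ->
    `|second_difference f p u v t - t ^+ 2 * 'D_v ('D_u f) p| <= t ^+ 2 * e.
Proof.
move=> df dg e e0.
pose g := 'D_u f.
(* The displacements [w1] and [w2] below have norms adding up to at most [t] times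
   [|u| + |u| + |v|]; the extra 1 makes the bounds strict and [M] positive. A relative error [e / M]
   then totals at most [t * e]. *)
pose M := `|u| + `|u| + `|v| + 1.
have M0 : 0 < M by rewrite /M ltr_wpDl // !addr_ge0.
have [d d0 Hd] := differentiable_bound _ _ dg (e / M) (divr_gt0 e0 M0).
exists (d / M); first exact: divr_gt0.
move=> t /andP[t0 td].
pose phi (s : R) := f (p + t *: v + s *: (t *: u)) - f (p + s *: (t *: u)).
have Dtu q : 'D_(t *: u) f q = t * g q.
  by rewrite /g (deriveE (t *: u) (df q)) (deriveE u (df q)) linearZ.
have Dphi s : is_derive s (1 : R) phi
    (t * g (p + t *: v + s *: (t *: u)) - t * g (p + s *: (t *: u))).
  by rewrite -!Dtu; apply: is_deriveB; apply: is_derive_line;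
     apply: diff_derivable; exact: df.
have [|c /andP[/= c0 c1]] := MVT (f := phi) ltr01 (fun s _ => Dphi s).
  apply: derivable_within_continuous => s _; exact: ex_derive.
rewrite !bnd_simp in c0 c1.
rewrite subr0 mulr1 -mulrBr => E.
have -> : second_difference f p u v t = phi 1 - phi 0.
  rewrite /second_difference /phi !scale1r !scale0r !addr0 [p + _ + _]addrAC.
  by ring.
rewrite E expr2 -!mulrA -mulrBr normrM (gtr0_norm t0) ler_pM2l //.
pose w1 := t *: v + c *: (t *: u); pose w2 := c *: (t *: u).
have ntu : `|w2| <= t * `|u|.
  rewrite /w2 !normrZ !gtr0_norm // -[leRHS]mul1r ler_wpM2r ?mulr_ge0 //;
  exact: ltW.
have nw1 : `|w1| <= t * `|v| + t * `|u|.
  by rewrite (le_trans (ler_normD _ _)) // lerD // normrZ gtr0_norm.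
have tM : t * M < d by rewrite -ltr_pdivlMr.
have tn1 : t * `|v| + t * `|u| < t * M.
  rewrite -mulrDr ltr_pM2l // /M; have := normr_ge0 u; lra.
have tn2 : t * `|u| < t * M.
  rewrite ltr_pM2l // /M; have := normr_ge0 u; have := normr_ge0 v; lra.
have B1 := Hd w1 (le_lt_trans nw1 (lt_trans tn1 tM)).
have B2 := Hd w2 (le_lt_trans ntu (lt_trans tn2 tM)).
have Ed : t * 'D_v g p = 'd g p w1 - 'd g p w2.
  by rewrite deriveE // -linearB /w1 /w2 addrK linearZ.
rewrite -[p + _ + _]addrA -/w1 -/w2 -/g Ed.
have -> : g (p + w1) - g (p + w2) - ('d g p w1 - 'd g p w2) =
  (g (p + w1) - g p - 'd g p w1) - (g (p + w2) - g p - 'd g p w2) by ring.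
apply: (le_trans (ler_normB _ _)); apply: (le_trans (lerD B1 B2)).
rewrite -mulrDr mulrAC ler_pdivrMr // [t * e]mulrC -mulrA ler_pM2l //.
apply: (le_trans (lerD nw1 ntu)); rewrite -!mulrDr ler_pM2l // /M; lra.
Qed.

(** The second difference is symmetric in [u] and [v], so for small [t] its quotient by [t ^+ 2] is
    within [e / 2] of both mixed derivatives. *)
Lemma derive_comm f p u v : (forall q, differentiable f q) ->
  differentiable ('D_u f) p -> differentiable ('D_v f) p ->
  'D_u ('D_v f) p = 'D_v ('D_u f) p.
Proof.
move=> df du dv; apply/eqP; rewrite -subr_eq0 -normr_le0.
apply/ler_addgt0Pr => e e0; rewrite add0r.
have e2 : 0 < e / 2 by rewrite divr_gt0.
have [d1 d10 H1] := second_difference_approx _ _ _ v df du _ e2.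
have [d2 d20 H2] := second_difference_approx _ _ _ u df dv _ e2.
pose t := Num.min d1 d2 / 2.
have m0 : 0 < Num.min d1 d2 by rewrite lt_min d10.
have t0 : 0 < t by rewrite divr_gt0.
have /andP[t1 t2] : (t < d1) && (t < d2).
  by rewrite -lt_min /t ltr_pdivrMr // ltr_pMr // ltrDl.
have := H1 t; have := H2 t; rewrite t0 t1 t2 => /(_ isT) B2 /(_ isT) B1.
rewrite second_difference_sym in B2.
set S := second_difference _ _ _ _ _ in B1 B2.
have tt : 0 < t ^+ 2 by rewrite exprn_gt0.
rewrite -(ler_pM2l tt) -[X in X * `|_|]gtr0_norm // -normrM.
set A := 'D_u ('D_v f) p in B2 *; set B := 'D_v ('D_u f) p in B1 *.
have -> : t ^+ 2 * (A - B) = (S - t ^+ 2 * B) - (S - t ^+ 2 * A).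
  by rewrite mulrBr opprB [RHS]addrC addrA subrK.
apply: (le_trans (ler_normB _ _)); apply: (le_trans (lerD B1 B2)).
by rewrite -mulrDr -splitr.
Qed.

End MixedPartials.

(** * Iterated directional derivatives and their symmetry *)

Section IteratedDerivatives.
Context {R : realType} {V : normedModType R}.
Implicit Types (f g : V -> R) (p u v : V) (vs ws : seq V).

Definition iter_derive vs f : V -> R := foldr (fun v g => 'D_v g) f vs.

Lemma iter_derive_cat vs ws f :
  iter_derive (vs ++ ws) f = iter_derive vs (iter_derive ws f).
Proof. exact: foldr_cat. Qed.

Lemma times_differentiableW (W : normedModType R) n m (F : V -> W) :
  (m <= n)%N -> times_differentiable n F -> times_differentiable m F.
Proof.
elim: m n F => [//|m IH] [//|n] F /= mn [dF DF].
by split => // v; apply: IH (DF v).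
Qed.

Lemma times_differentiable_iter m vs f :
  times_differentiable (size vs + m) f ->
  times_differentiable m (iter_derive vs f).
Proof.
elim: vs m f => [//|v vs IH] m f df.
by apply: (proj2 (IH m.+1 f _)); rewrite addnS.
Qed.

Lemma times_differentiable_coord n T (F : V -> 'rV[R]_T) (i : 'I_T) :
  times_differentiable n F -> times_differentiable n (fun p => F p 0 i).
Proof.
elim: n F => [//|n IH] F /= [dF DF]; split => [p|v].
  exact: (differentiable_comp (dF p) (differentiable_coord _ _ _)).
have -> : 'D_v (fun p => F p 0 i) = fun p => 'D_v F p 0 i; last exact: IH.
by apply/funext => p; rewrite derive_mx ?mxE //; apply: diff_derivable.
Qed.

(** [v] is exchanged with its left neighbours one at a time. At each exchange two directions are
    outermost, which leaves the inner derivative twice differentiable, as Schwarz's theorem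
    requires. *)
Lemma iter_derive_move v vs ws f :
  times_differentiable (size (vs ++ v :: ws)) f ->
  iter_derive (vs ++ v :: ws) f = iter_derive (v :: vs ++ ws) f.
Proof.
elim: vs => [//|u vs IH] df; rewrite [LHS]/= IH; last first.
  by apply: times_differentiableW df; rewrite leqnSn.
have d2 : times_differentiable 2 (iter_derive (vs ++ ws) f).
  apply: times_differentiable_iter; apply: times_differentiableW df.
  by rewrite /= !size_cat /= !addnS addn0.
apply/funext => p /=; apply: derive_comm; first exact: (proj1 d2).
  by apply: (proj1 (proj2 d2 u)).
by apply: (proj1 (proj2 d2 v)).
Qed.

Lemma perm_iter_derive vs ws f : perm_eq vs ws ->
  times_differentiable (size vs) f -> iter_derive vs f = iter_derive ws f.
Proof.
elim: vs ws => [|v vs IH] ws pvw.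
  by move: pvw; rewrite perm_sym => /perm_nilP ->.
have vws : v \in ws by rewrite -(perm_mem pvw) mem_head.
case/splitPr: ws / vws pvw => ws1 ws2 pvw df.
rewrite iter_derive_move -?(perm_size pvw) //=.
rewrite (IH (ws1 ++ ws2)) //; last exact: times_differentiableW df.
move: pvw; rewrite -[v :: ws2]cat1s perm_sym perm_catCA /= perm_cons.
by rewrite perm_sym.
Qed.

Lemma is_derive_sumZ (W : normedModType R) (I : Type) (r : seq I) (P : pred I)
    (c : I -> R) (h : I -> V -> W) (dh : I -> W) p v :
  (forall i, P i -> is_derive p v (h i) (dh i)) ->
  is_derive p v (fun q => \sum_(i <- r | P i) c i *: h i q)
    (\sum_(i <- r | P i) c i *: dh i).
Proof.
move=> dh'; elim: r => [|i r IH].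
  rewrite big_nil; under eq_fun do rewrite big_nil; exact: is_derive_cst.
rewrite big_cons; under eq_fun do rewrite big_cons.
case: ifP => // Pi.
apply: is_deriveD; apply: is_deriveZ; exact: dh'.
Qed.

Lemma derive_sum_direction (I : Type) (r : seq I) (P : pred I)
    (c : I -> R) (w : I -> V) f p : differentiable f p ->
  'D_(\sum_(i <- r | P i) c i *: w i) f p =
  \sum_(i <- r | P i) c i * 'D_(w i) f p.
Proof.
move=> df; rewrite deriveE // linear_sum; apply: eq_bigr => i _.
by rewrite linearZ deriveE.
Qed.

End IteratedDerivatives.

(** * Derivative tensors as iterated directional derivatives *)

Lemma big_tuple_cons (S : Type) (idx : S) (op : Monoid.com_law idx)
    (I : finType) n (G : n.+1.-tuple I -> S) :
  \big[op/idx]_(t : n.+1.-tuple I) G t =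
  \big[op/idx]_(i : I) \big[op/idx]_(t : n.-tuple I) G [tuple of i :: t].
Proof.
rewrite pair_bigA /=.
rewrite (reindex (fun q : I * n.-tuple I => [tuple of q.1 :: q.2])) //.
exists (fun t => (thead t, [tuple of behead t])) => [[i t] _|t _] /=.
  by rewrite theadE; congr pair; apply: val_inj.
by rewrite [RHS]tuple_eta.
Qed.

Section DerivativeTensorAsIteratedDerivative.
Context {R : realType} {T : nat}.
Implicit Types (g : 'rV[R]_T * R -> R) (F : 'rV[R]_T * R -> 'rV[R]_T).
Implicit Types (p : 'rV[R]_T * R) (vs : seq 'rV[R]_T).

Definition x_direction (v : 'rV[R]_T) : 'rV[R]_T * R := (v, 0).

Definition beta_direction : 'rV[R]_T * R := (0, 1).

Lemma x_direction_sum_delta (v : 'rV[R]_T) :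
  x_direction v = \sum_j v 0 j *: x_direction (delta_mx 0 j).
Proof.
rewrite /x_direction [v in LHS]row_sum_delta.
elim/big_rec2: _ => // i [a b] c _ <-; congr pair => /=.
by rewrite scaler0 addr0.
Qed.

(** Multilinearity: by induction, each direction is expanded in the standard basis, the outermost
    one contributing the first index of the tuple. *)
Lemma iter_derive_tensor vs g p : times_differentiable (size vs) g ->
  iter_derive (map x_direction vs) g p =
  \sum_(js : (size vs).-tuple 'I_T)
    (\prod_(k < size vs) vs`_k 0 (tnth js k)) * foldr partial_x g js p.
Proof.
elim: vs p => [|v vs IH] p dg /=.
  rewrite (big_pred1 [tuple]) ?big_ord0 ?mul1r // => t /=.
  by rewrite tuple0; apply/esym/eqP.
have -> : iter_derive (map x_direction vs) g = fun q =>
  \sum_(js : (size vs).-tuple 'I_T)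
    (\prod_(k < size vs) vs`_k 0 (tnth js k)) *: foldr partial_x g js q.
  by apply/funext => q; apply: IH; apply: times_differentiableW dg.
have d1 (js : (size vs).-tuple 'I_T) : differentiable (foldr partial_x g js) p.
  have -> : foldr partial_x g js =
      iter_derive [seq x_direction (delta_mx 0 j) | j <- js] g.
    by rewrite /iter_derive foldr_map.
  suff /proj1 : times_differentiable 1
    (iter_derive [seq x_direction (delta_mx 0 j) | j <- js] g) by apply.
  by apply: times_differentiable_iter; rewrite size_map size_tuple addn1.
have := is_derive_sumZ _ _ (index_enum _) xpredT
  (fun js : (size vs).-tuple 'I_T => \prod_(k < size vs) vs`_k 0 (tnth js k))
  _ _ _ _ (fun js _ =>
    @derivableP _ _ _ _ p (x_direction v) (diff_derivable (d1 js))).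
move=> /@derive_val ->; rewrite big_tuple_cons exchange_big /=.
apply: eq_bigr => js _.
rewrite x_direction_sum_delta derive_sum_direction // /GRing.scale /= mulr_sumr.
apply: eq_bigr => j _; rewrite big_ord_recl /= mulrA; congr (_ * _).
rewrite mulrC tnth0; congr (_ * _); apply: eq_bigr => k _.
by rewrite tnthS.
Qed.

(** Translates tensors into iterated derivatives, whose directions may be permuted. The beta
    directions come last because the tensor takes the beta derivatives first. *)
Lemma derivative_tensorE F b vs p (i : 'I_T) :
  times_differentiable (size vs + b) F ->
  derivative_tensor F b vs p 0 i =
  iter_derive (map x_direction vs ++ nseq b beta_direction)
    (fun q => F q 0 i) p.
Proof.
move=> dF; rewrite mxE iter_derive_cat.
have -> : iter_derive (nseq b beta_direction) (fun q => F q 0 i) =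
    iter b partial_beta (fun q => F q 0 i).
  by elim: b {dF} => //= b ->.
rewrite -iter_derive_tensor //.
have -> : iter b partial_beta (fun q => F q 0 i) =
  iter_derive (nseq b beta_direction) (fun q => F q 0 i).
  by elim: b {dF} => //= b ->.
apply: times_differentiable_iter; rewrite size_nseq addnC.
exact: times_differentiable_coord.
Qed.

End DerivativeTensorAsIteratedDerivative.

(** * Higher derivatives on an open subset of the line *)

Section DerivativesOnOpenSet.
Context {R : realType} {U : set R}.
Hypothesis oU : open U.

(** Stated on a whole open set rather than at one point: a derivative depends on nearby values, so
    only such a notion can be iterated. *)
Definition times_derivable_on {W : normedModType R} n (g : R -> W) :=
  forall t, U t -> forall k, (k < n)%N -> derivable (g^`(k)) t 1.

Lemma times_derivable_onS {W : normedModType R} n (g : R -> W) :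
  times_derivable_on n.+1 g <->
  (forall t, U t -> derivable g t 1) /\ times_derivable_on n (g^`()).
Proof.
split=> [dg|[dg dg'] t Ut [|k] kn]; last by rewrite derive1Sn; apply: dg'.
  split=> t Ut => [|k kn]; first exact: (dg t Ut 0%N).
  by rewrite -derive1Sn; apply: dg.
exact: dg.
Qed.

Lemma times_derivable_onW {W : normedModType R} n m (g : R -> W) :
  (m <= n)%N -> times_derivable_on n g -> times_derivable_on m g.
Proof. by move=> mn dg t Ut k km; apply: dg => //; apply: leq_trans mn. Qed.

Lemma near_open (P : R -> Prop) t : U t -> (forall s, U s -> P s) ->
  \forall s \near t, P s.
Proof. by move=> Ut PU; exact: filterS PU (open_nbhs_nbhs (conj oU Ut)). Qed.

(** Functions equal on the open set [U] agree near each of its points. This allows a formula for a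
    first derivative that is valid only on [U] to be differentiated again. *)
Lemma eq_derive1n_on {W : normedModType R} n (g h : R -> W) :
  (forall t, U t -> g t = h t) -> forall t, U t -> g^`(n) t = h^`(n) t.
Proof.
elim: n g h => [//|n IH] g h gh t Ut; rewrite !derive1nS !derive1E.
apply: near_eq_derive; apply: near_open Ut _; exact: IH.
Qed.

Lemma eq_times_derivable_on {W : normedModType R} n (g h : R -> W) :
  (forall t, U t -> g t = h t) ->
  times_derivable_on n g -> times_derivable_on n h.
Proof.
move=> gh dg t Ut k kn; apply: near_eq_derivable (dg t Ut k kn).
apply: near_open Ut _; exact: eq_derive1n_on.
Qed.

Lemma derive1n_sumZ_on (I : Type) (r : seq I) (c : I -> R) (h : I -> R -> R)
    n : (forall i, times_derivable_on n (h i)) ->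
  times_derivable_on n (fun t => \sum_(i <- r) c i * h i t) /\
  (forall t, U t -> (fun t => \sum_(i <- r) c i * h i t)^`(n) t =
                    \sum_(i <- r) c i * derive1n n (h i) t).
Proof.
elim: n h => [//|n IH] h dh.
have dh' i : times_derivable_on n ((h i)^`()).
  by case/times_derivable_onS: (dh i).
have dS t (Ut : U t) := is_derive_sumZ _ _ r xpredT c h _ t 1
  (fun i _ => @derivableP _ _ _ _ t 1 (dh i t Ut 0%N isT)).
have ES t : U t -> (fun t => \sum_(i <- r) c i * h i t)^`() t =
    \sum_(i <- r) c i * derive1 (h i) t.
  move=> Ut; rewrite derive1E; have /@derive_val -> := dS t Ut.
  by apply: eq_bigr => i _; rewrite derive1E.
have [d' E'] := IH _ dh'; split=> [|t Ut].
  apply/times_derivable_onS; split=> [t Ut|]; first by have := dS t Ut; case.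
  by apply: eq_times_derivable_on d' => t Ut; rewrite ES.
rewrite derive1Sn (eq_derive1n_on _ _ _ ES) // E' //.
by apply: eq_bigr => i _; rewrite derive1Sn.
Qed.

Lemma derive1nD_on (g h : R -> R) n :
  times_derivable_on n g -> times_derivable_on n h ->
  times_derivable_on n (fun t => g t + h t) /\
  (forall t, U t -> (fun t => g t + h t)^`(n) t =
                    derive1n n g t + derive1n n h t).
Proof.
move=> dg dh.
have E : (fun t => g t + h t) =
    fun t => \sum_(b <- [:: true; false]) 1 * (if b then g else h) t.
  by apply/funext => t; rewrite !big_cons big_nil addr0 !mul1r.
have [|d D] := derive1n_sumZ_on _ [:: true; false] (fun=> 1)
  (fun b => if b then g else h) n; first by case.
rewrite E; split=> // t Ut; rewrite D //.
by rewrite !big_cons big_nil addr0 !mul1r.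
Qed.

(** Leibniz's rule, by induction from the first-order product rule; both resulting sums are merged
    by Pascal's rule. *)
Lemma derive1nM_on (g h : R -> R) n :
  times_derivable_on n g -> times_derivable_on n h ->
  times_derivable_on n (fun t => g t * h t) /\
  (forall t, U t -> (fun t => g t * h t)^`(n) t =
    \sum_(k < n.+1) 'C(n, k)%:R * (derive1n k g t * derive1n (n - k) h t)).
Proof.
elim: n g h => [|n IH] g h dg dh.
  split=> [t Ut k|t Ut]; first by rewrite ltn0.
  by rewrite big_ord1 subn0 bin0 mul1r.
have [dg0 dg'] := (times_derivable_onS _ _).1 dg.
have [dh0 dh'] := (times_derivable_onS _ _).1 dh.
have dP t (Ut : U t) :=
  is_deriveM (derivableP (dg0 t Ut)) (derivableP (dh0 t Ut)).
have EP t : U t -> (fun t => g t * h t)^`() t =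
    derive1 g t * h t + g t * derive1 h t.
  move=> Ut; rewrite derive1E; have /@derive_val -> := dP t Ut.
  by rewrite /GRing.scale /= !derive1E addrC (mulrC (h t)).
have [d1 E1] := IH _ _ dg' (times_derivable_onW _ _ _ (leqnSn n) dh).
have [d2 E2] := IH _ _ (times_derivable_onW _ _ _ (leqnSn n) dg) dh'.
have [d3 E3] := derive1nD_on _ _ _ d1 d2.
split=> [|t Ut].
  apply/times_derivable_onS; split=> [t Ut|]; first by have := dP t Ut; case.
  by apply: eq_times_derivable_on d3 => t Ut; rewrite EP.
rewrite derive1Sn (eq_derive1n_on _ _ _ EP) // E3 // E1 // E2 //.
under eq_bigr do rewrite -derive1Sn.
under [X in _ + X]eq_bigr do rewrite -derive1Sn -subSn -1?ltnS //.
rewrite [in RHS]big_ord_recl /= bin0.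
rewrite [X in _ + X]big_ord_recl /= bin0 addrCA; congr (_ + _).
under [in RHS]eq_bigr => i _ do rewrite /bump /= add1n subSS binS natrD mulrDl.
rewrite big_split /= addrC; congr (_ + _).
(* The last term of this half of Pascal's rule carries ['C(n, n.+1)], which is 0. *)
rewrite [in RHS]big_ord_recr /= bin_small // mul0r addr0.
by apply: eq_bigr => i _; rewrite /bump /= add1n subSS.
Qed.

End DerivativesOnOpenSet.

Arguments times_derivable_on {R} U {W} n g.

(** * Derivatives of a function along the curve *)

Section ChainRule.
Context {R : realType} {T : nat} {U : set R}.
Hypothesis oU : open U.
Variable x : R -> 'rV[R]_T.
Implicit Types (f : 'rV[R]_T * R -> R) (v : 'rV[R]_T).

Local Notation "f '\at_curve'" := (fun t : R => f (x t, t)) (at level 10).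
Local Notation D_x v f := ('D_(x_direction v) f).
Local Notation D_beta f := ('D_beta_direction f).

Lemma derive_x_sum v f p : differentiable f p ->
  D_x v f p = \sum_j v 0 j * D_x (delta_mx 0 j) f p.
Proof. by move=> df; rewrite x_direction_sum_delta derive_sum_direction. Qed.

(** The curve [(x s, s)] has velocity [(x'(t), 1)], the sum of an x direction and the beta
    direction. The x part is written in coordinates so that each term is a product of scalar
    functions, to which Leibniz's rule applies. *)
Lemma is_derive_curve f t : (forall p, differentiable f p) ->
  derivable x t 1 ->
  is_derive t 1 (f \at_curve)
    (\sum_j derive1 x t 0 j * D_x (delta_mx 0 j) f (x t, t) +
     D_beta f (x t, t)).
Proof.
move=> df dx.
have dx' : differentiable x t by apply/derivable1_diffP.
have dz : differentiable (fun s : R => (x s, s)) t.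
  by apply: differentiable_pair.
have dfz := differentiable_comp dz (df (x t, t)).
split; first exact: diff_derivable.
rewrite -derive_x_sum // deriveE // (diff_comp dz (df _)) /= diff_pair //.
rewrite -derive1E' // !deriveE // -linearD; congr ('d f _ _).
rewrite /x_direction /beta_direction /= diff_val.
by congr pair; rewrite ?addr0 ?add0r.
Qed.

Lemma derive1n_coord n t j : times_derivable_on U n x -> U t ->
  (fun s => x s 0 j)^`(n) t = x^`(n) t 0 j.
Proof.
elim: n t => [//|n IH] t dx Ut; rewrite !derive1nS !derive1E.
rewrite derive_mx ?mxE; last exact: dx.
apply: near_eq_derive; apply: (near_open oU) Ut _ => s Us.
by apply: IH => //; apply: times_derivable_onW dx.
Qed.

Lemma times_derivable_on_coord n j : times_derivable_on U n x ->
  times_derivable_on U n (fun s => x s 0 j).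
Proof.
move=> dx t Ut k kn.
have := dx t Ut k kn => /derivable_mxP/(_ 0 j); apply: near_eq_derivable.
apply: (near_open oU) Ut _ => s Us; rewrite derive1n_coord //.
by apply: times_derivable_onW dx; apply: ltnW.
Qed.

(** The chain rule followed by Leibniz's rule in each coordinate. In the result the direction is
    frozen at the value of the derivative of [x] at [t], so each term is again a derivative of a
    fixed function along the curve. *)
Lemma derive1n_curve n f : times_derivable_on U n x ->
  times_differentiable n f -> times_derivable_on U n (f \at_curve) /\
  (forall m, n = m.+1 -> forall t, U t -> (f \at_curve)^`(n) t =
     \sum_(k < n) 'C(m, k)%:R *
       derive1n (m - k) (D_x (derive1n k.+1 x t) f \at_curve) t +
     derive1n m (D_beta f \at_curve) t).
Proof.
elim: n f => [//|n IH] f dx df.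
have [df0 dfv] := df; have [dx0 dx'] := (times_derivable_onS _ _).1 dx.
have dxn := times_derivable_onW _ _ _ (leqnSn n) dx.
have dc t (Ut : U t) := is_derive_curve _ _ df0 (dx0 t Ut).
have Ec t : U t -> (f \at_curve)^`() t =
  \sum_j 1 * (derive1 (fun s => x s 0 j) t *
              (D_x (delta_mx 0 j) f \at_curve) t) + (D_beta f \at_curve) t.
  move=> Ut; rewrite derive1E; have /@derive_val -> := dc t Ut.
  congr (_ + _); apply: eq_bigr => j _; rewrite mul1r; congr (_ * _).
  have := derive1n_coord 1 t j; rewrite !derive1n1 => -> //.
  exact: times_derivable_onW dx.
have dj j : times_derivable_on U n ((fun s => x s 0 j)^`()).
  by have /times_derivable_onS[] := times_derivable_on_coord _ j dx.
have djf (v : 'rV[R]_T * R) := (IH _ dxn (dfv v)).1.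
have dp j := derive1nM_on oU _ _ _ (dj j) (djf (x_direction (delta_mx 0 j))).
have [dS ES] := derive1n_sumZ_on oU _ (index_enum 'I_T) (fun=> 1) _ _
   (fun j => (dp j).1).
have [dt Et] := derive1nD_on oU _ _ _ dS (djf beta_direction).
split=> [|m [<-] t Ut].
  apply/times_derivable_onS; split=> [t Ut|]; first by have := dc t Ut; case.
  by apply: (eq_times_derivable_on oU) dt => t Ut; rewrite Ec.
rewrite derive1Sn (eq_derive1n_on oU _ _ _ Ec) // Et // ES //; congr (_ + _).
under eq_bigr do rewrite mul1r (dp _).2 //.
rewrite exchange_big /=; apply: eq_bigr => k _; rewrite -mulr_sumr.
congr (_ * _).
(* The coordinates are regrouped into one direction: its coefficients are constants in [s], hence
   pass through the derivatives. *)
rewrite [RHS](eq_derive1n_on oU (n - k) _ (fun s =>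
    \sum_j derive1n k.+1 x t 0 j * (D_x (delta_mx 0 j) f \at_curve) s)) //;
  last by move=> s _; rewrite derive_x_sum.
rewrite (derive1n_sumZ_on oU _ _ _ _ _ _).2 //; last first.
  move=> j; apply: times_derivable_onW (djf _); exact: leq_subr.
apply: eq_bigr => j _; congr (_ * _); rewrite -derive1Sn derive1n_coord //.
by apply: times_derivable_onW dx; rewrite ltnS -ltnS.
Qed.

End ChainRule.

(** * Solving the Bell recursion by Euler's identity *)

Section BellExpansion.
Context {R : realType} {V : normedModType R} {I : finType} {N : nat}.
Variables (p : I -> nat) (w : I -> V).
Hypothesis p_gt0 : forall i, (0 < p i)%N.
Implicit Types (mu : {ffun I -> 'I_N.+1}) (f : V -> R).

(** Exponents live in ['I_N.+1] to make the multi-indices a finite type. Each [p i] is positive, so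
    exponents never exceed the weight and no multi-index of weight at most [N] is lost. *)
Definition weight mu : nat := \sum_i p i * mu i.

(** Coefficient of the monomial with exponents [mu] in the exponential of [sum_i y_i / (p i)!]. *)
Definition mu_coef mu : R := (\prod_i ((mu i)`! * (p i)`! ^ mu i))%N%:R^-1.

Definition mu_args mu : seq V := flatten [seq nseq (mu i) (w i) | i <- enum I].

Definition upd mu i k : {ffun I -> 'I_N.+1} :=
  [ffun j => if j == i then inord k else mu j].

Lemma weight_upd mu i k : (k <= N)%N ->
  (weight (upd mu i k) + p i * mu i = weight mu + p i * k)%N.
Proof.
move=> kN; rewrite /weight.
rewrite (bigD1 i) //= [in RHS](bigD1 i) //= ffunE eqxx inordK //.
under eq_bigr => j /negPf ji do rewrite ffunE ji.
by rewrite addnAC [RHS]addnAC (addnC (p i * k)%N).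
Qed.

(* [mu i < N] keeps [inord] in [upd] away from its junk value. *)
Lemma mu_coef_updS mu i : (mu i < N)%N ->
  mu_coef (upd mu i (mu i).+1) * (mu i).+1%:R = mu_coef mu / (p i)`!%:R.
Proof.
move=> iN; rewrite /mu_coef.
rewrite (bigD1 i) //= [in RHS](bigD1 i) //= ffunE eqxx inordK //.
under eq_bigr => j /negPf ji do rewrite ffunE ji.
set P := bigop _ _ _.
rewrite factS expnS !natrM !invfM.
have S0 : (mu i).+1%:R != 0 :> R by rewrite pnatr_eq0.
rewrite [LHS]mulrC -!mulrA mulVKf //; congr (_ * _).
by rewrite mulrC -!mulrA.
Qed.

Lemma count_mu_args a mu : count a (mu_args mu) = (\sum_i mu i * a (w i))%N.
Proof.
rewrite count_flatten -map_comp sumnE big_map big_enum /=.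
by apply: eq_bigr => i _; rewrite count_nseq mulnC.
Qed.

Lemma size_mu_args mu : (size (mu_args mu) <= weight mu)%N.
Proof.
rewrite -count_predT count_mu_args leq_sum // => i _.
by rewrite muln1 leq_pmull.
Qed.

(** The new [w i] stands at the end because the recursion [bS] differentiates [f] along it first;
    symmetry of derivatives lets it join its block. *)
Lemma perm_mu_args_updS mu i : (mu i < N)%N ->
  perm_eq (mu_args mu ++ [:: w i]) (mu_args (upd mu i (mu i).+1)).
Proof.
move=> iN; apply/permP => a; rewrite count_cat !count_mu_args /= addn0.
rewrite (bigD1 i) //= [in RHS](bigD1 i) //= ffunE eqxx inordK //.
under [in RHS]eq_bigr => j /negPf ji do rewrite ffunE ji.
by rewrite mulSn addnC addnA.
Qed.

(** Terms with [mu i = 0] vanish; lowering the [i]-th exponent by one maps the others bijectively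
    onto the multi-indices of weight [n.+1 - p i]. *)
Lemma reindex_updS i n (G : {ffun I -> 'I_N.+1} -> R) : (n < N)%N ->
  \sum_(mu | weight mu == n.+1) (mu i)%:R * G mu =
  if (p i <= n.+1)%N then
    \sum_(mu | weight mu == (n.+1 - p i)%N)
      (mu i).+1%:R * G (upd mu i (mu i).+1)
  else 0.
Proof.
move=> nN.
have le_w mu : (p i * mu i <= weight mu)%N.
  by rewrite /weight (bigD1 i) //= leq_addr.
rewrite (bigID (fun mu => mu i == ord0)) /= big1 ?add0r; last first.
  by move=> mu /andP[_ /eqP->]; rewrite mul0r.
case: leqP => pin; last first.
  rewrite big1 // => mu /andP[/eqP wmu mui]; move: (le_w mu); rewrite wmu.
  rewrite leqNgt (leq_trans pin) // leq_pmulr // lt0n.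
  by apply: contra mui => /eqP mui; apply/eqP/val_inj.
rewrite (reindex_onto (fun mu => upd mu i (mu i).+1)
                      (fun mu => upd mu i (mu i).-1)); last first.
  move=> mu /andP[_ mui]; apply/ffunP => j; rewrite !ffunE.
  case: eqP => // ->; apply: val_inj.
  have E : @inord N (mu i).-1 = (mu i).-1 :> nat.
    by rewrite inordK // ltnS (leq_trans (leq_pred _)) // -ltnS.
  by rewrite /= eqxx E prednK ?lt0n // inordK.
have H mu : (mu i < N)%N -> upd mu i (mu i).+1 i = (mu i).+1 :> nat.
  by move=> iN; rewrite ffunE eqxx inordK.
apply: congr_big => // [mu|mu /andP[/andP[wmu mui] hK]]; last first.
  rewrite H // ltnNge; apply: contra mui => Ni.
  rewrite ffunE eqxx; apply/eqP/val_inj.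
  have -> : mu i = N :> nat by apply/anti_leq; rewrite Ni -ltnS ltn_ord.
  by rewrite /inord /insubd insubF //= ltnn.
have [iN|Ni] := ltnP (mu i) N.
  have Hi := H _ iN.
  have -> : (upd mu i (mu i).+1 i == ord0) = false.
    by apply/eqP => /(congr1 val) /=; rewrite Hi.
  have -> : upd (upd mu i (mu i).+1) i (upd mu i (mu i).+1 i).-1 = mu.
    rewrite Hi /=; apply/ffunP => j; rewrite !ffunE.
    by case: eqP => // ->; apply: val_inj; rewrite /= inordK.
  rewrite eqxx !andbT.
  have := weight_upd mu i (mu i).+1 iN; rewrite mulnS addnA => /addIn ->.
  by rewrite -(eqn_add2r (p i) (weight mu)) subnK.
(* Here [inord] sends [N.+1] to 0, so the left condition fails; the right one fails too, because the
   weight of [mu] is at least [N], hence above [n]. *)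
have Ei : mu i = N :> nat by apply/anti_leq; rewrite Ni -ltnS ltn_ord.
have -> : upd mu i (mu i).+1 i = ord0.
  rewrite ffunE eqxx; apply: val_inj.
  by rewrite Ei /inord /insubd insubF //= ltnn.
rewrite eqxx /= andbF /=; apply/esym/negbTE; rewrite neq_ltn; apply/orP; right.
apply: leq_trans (le_w mu); rewrite Ei.
apply: (@leq_trans N); last by rewrite leq_pmull.
by rewrite (leq_trans _ nN) // ltnS leq_subLR -[X in (X <= _)%N]add1n leq_add2r.
Qed.

(** [b n f] stands for the [n]-th derivative of [f] along the curve divided by [n!], and [bS] for
    the chain rule in this normalization. *)
Variable (z : V) (b : nat -> (V -> R) -> R).
Hypothesis b0 : forall f, b 0 f = f z.
Hypothesis bS : forall n f, (n < N)%N -> times_differentiable n.+1 f ->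
  n.+1%:R * b n.+1 f =
  \sum_(i | (p i <= n.+1)%N)
    (p i)%:R / (p i)`!%:R * b (n.+1 - p i) ('D_(w i) f).

(* Both sides satisfy [bS]: for the sum, write [n.+1] as
   [\sum_i p i * mu i] and reindex the [i]-th term by removing one [w i]. *)
Lemma bell_expansion n f : (n <= N)%N -> times_differentiable n f ->
  b n f = \sum_(mu | weight mu == n) mu_coef mu * iter_derive (mu_args mu) f z.
Proof.
elim/ltn_ind: n f => -[_ f _ _|n IH f nN df].
  rewrite b0 (big_pred1 [ffun=> ord0]) => [|mu].
    rewrite /mu_coef big1 ?invr1 ?mul1r => [|i _]; last by rewrite ffunE.
    have -> : mu_args [ffun=> ord0] = [::]; last by [].
    apply/size0nil/eqP; rewrite -leqn0; apply: leq_trans (size_mu_args _) _.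
    by rewrite leqn0 /weight big1 // => i _; rewrite ffunE muln0.
  rewrite /weight sum_nat_eq0; apply/forallP/eqP => [mu0|-> i].
    apply/ffunP => i; apply: val_inj; rewrite ffunE /=.
    by have /= := mu0 i; rewrite muln_eq0 eqn0Ngt p_gt0 => /eqP.
  by rewrite ffunE muln0.
apply: (mulfI (_ : n.+1%:R != 0)); first by rewrite pnatr_eq0.
rewrite bS //.
pose G mu := mu_coef mu * iter_derive (mu_args mu) f z.
have -> : n.+1%:R * (\sum_(mu | weight mu == n.+1) G mu) =
    \sum_i (p i)%:R * \sum_(mu | weight mu == n.+1) (mu i)%:R * G mu.
  under [RHS]eq_bigr do rewrite mulr_sumr.
  rewrite exchange_big mulr_sumr /=.
  apply: eq_bigr => mu /eqP wmu.
  rewrite -wmu natr_sum mulr_suml; apply: eq_bigr => i _.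
  by rewrite natrM mulrA.
rewrite big_mkcond; apply: eq_bigr => i _; rewrite reindex_updS //.
case: ifP => pin; last by rewrite mulr0.
rewrite -mulrA; congr (_ * _).
rewrite IH; last first.
- case: df => _ /(_ (w i)); apply: times_differentiableW.
  by rewrite leq_subLR -add1n leq_add2r.
- by rewrite (leq_trans (leq_subr _ _)).
- by rewrite ltnS leq_subLR -add1n leq_add2r.
rewrite mulr_sumr; apply: eq_bigr => mu /eqP wmu.
have iN : (mu i < N)%N.
  apply: (@leq_ltn_trans n) => //.
  apply: (@leq_trans (weight mu)).
    rewrite /weight (bigD1 i) //= (leq_trans _ (leq_addr _ _)) //.
    by rewrite leq_pmull.
  by rewrite wmu leq_subLR -[X in (X <= _)%N]add1n leq_add2r.
rewrite /G mulrA [_ * mu_coef _]mulrC mu_coef_updS // mulrC -!mulrA.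
congr (_ * _).
rewrite mulrC; congr (_ * _).
rewrite -[iter_derive _ ('D__ f)](iter_derive_cat _ [:: w i] f).
rewrite (perm_iter_derive _ _ _ (perm_mu_args_updS _ _ iN)) //.
apply: times_differentiableW df; rewrite size_cat addn1 ltnS.
apply: leq_trans (size_mu_args _) _.
by rewrite wmu leq_subLR -[X in (X <= _)%N]add1n leq_add2r.
Qed.

End BellExpansion.

(** * Partitions with a number of beta directions as multi-indices *)

Section PartitionsAsMultiplicities.
Implicit Types (s lam : seq (nat * nat)) (k l b : nat).

(** A total function of the part, with value 0 on absent parts; when the parts are distinct the sum
    has at most one term. *)
Definition mult s k : nat := \sum_(q <- s | q.2 == k) q.1.

Lemma mult_notin s k : k \notin [seq q.2 | q <- s] -> mult s k = 0%N.
Proof.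
move=> ks; rewrite /mult big_seq_cond big1 // => q /andP[qs /eqP qk].
by move: ks; rewrite -qk map_f.
Qed.

Lemma mult_in s q : uniq [seq r.2 | r <- s] -> q \in s -> mult s q.2 = q.1.
Proof.
elim: s => [//|r s IH] /= /andP[rs us]; rewrite inE /mult big_cons.
case/predU1P => [->|qs].
  by rewrite eqxx [X in (_ + X)%N]mult_notin ?addn0.
rewrite ifN; first exact: IH.
by apply: contra rs => /eqP->; apply: map_f.
Qed.

(** Absent parts have multiplicity 0 and contribute the neutral element. *)
Lemma big_mult (S : Type) (idx : S) (op : Monoid.com_law idx)
    (phi : nat -> nat -> S) s l :
  (forall k, phi 0%N k = idx) -> uniq [seq q.2 | q <- s] ->
  (forall q, q \in s -> 0 < q.2 <= l)%N ->
  \big[op/idx]_(q <- s) phi q.1 q.2 =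
  \big[op/idx]_(k < l) phi (mult s k.+1) k.+1.
Proof.
move=> phi0 us sl.
transitivity (\big[op/idx]_(k <- [seq q.2 | q <- s]) phi (mult s k) k).
  by rewrite big_map; apply: eq_big_seq => q /(mult_in _ _ us) ->.
rewrite -(big_mkord xpredT (fun k => phi (mult s k.+1) k.+1)) /=.
rewrite -(big_add1 _ _ 0 l.+1 xpredT (fun k => phi (mult s k) k)).
rewrite /index_iota subn1 /=.
rewrite [RHS](bigID (mem [seq q.2 | q <- s])) /=.
rewrite [X in op _ X]big1 ?Monoid.mulm1.
  rewrite -[RHS]big_filter; apply/perm_big/uniq_perm => //.
    by rewrite filter_uniq ?iota_uniq.
  move=> k; rewrite mem_filter mem_iota add1n ltnS.
  case: (boolP (k \in _)) => //= /mapP[q qs ->]; by rewrite sl.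
by move=> k /mult_notin ->.
Qed.

Variable l : nat.
Hypothesis l_gt0 : (0 < l)%N.
Implicit Type mu : {ffun 'I_l.+1 -> 'I_l.+1}.

Lemma partition_uniq lam : is_partition l lam -> uniq [seq q.2 | q <- lam].
Proof.
case/and3P => sl _ _.
by apply: sorted_uniq sl; [exact: ltn_trans|exact: ltnn].
Qed.

Lemma partition_le lam q : is_partition l lam -> q \in lam ->
  [&& 0 < q.1, 0 < q.2 & q.1 * q.2 <= l]%N.
Proof.
case/and3P => _ /allP pos /eqP <- qlam; have /andP[-> ->] := pos _ qlam.
by rewrite /= (big_rem q) //= leq_addr.
Qed.

Lemma partition_part_le lam q : is_partition l lam -> q \in lam ->
  (0 < q.2 <= l)%N.
Proof.
move=> plam /(partition_le _ _ plam)/and3P[q1 -> le] /=.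
by apply: leq_trans le; rewrite leq_pmull.
Qed.

Lemma partition_mult_le lam k : is_partition l lam -> (mult lam k <= l)%N.
Proof.
move=> plam; have [/mapP[q qlam ->]|/mult_notin-> //] :=
  boolP (k \in [seq q.2 | q <- lam]).
rewrite (mult_in _ _ (partition_uniq _ plam) qlam).
have /and3P[_ q2 le] := partition_le _ _ plam qlam.
by apply: leq_trans le; rewrite leq_pmulr.
Qed.

(** Inverse of [mult] on the partitions of [l]. *)
Definition seq_of_mult (M : nat -> nat) : seq (nat * nat) :=
  [seq (M k, k) | k <- iota 1 l & (0 < M k)%N].

Lemma eq_seq_of_mult M1 M2 : (forall k, (0 < k <= l)%N -> M1 k = M2 k) ->
  seq_of_mult M1 = seq_of_mult M2.
Proof.
move=> M12; have H k : k \in iota 1 l -> M1 k = M2 k.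
  by rewrite mem_iota add1n ltnS => /M12.
rewrite /seq_of_mult; have -> : [seq k <- iota 1 l | (0 < M1 k)%N] =
    [seq k <- iota 1 l | (0 < M2 k)%N].
  by apply: eq_in_filter => k /H ->.
by apply/eq_in_map => k; rewrite mem_filter => /andP[_ /H ->].
Qed.

Lemma mem_seq_of_mult M q :
  (q \in seq_of_mult M) = [&& 0 < M q.2, 0 < q.2 <= l & q.1 == M q.2]%N.
Proof.
apply/mapP/and3P => [[k]|[Mq ql /eqP q1]].
  by rewrite mem_filter mem_iota add1n ltnS => /andP[? ?] -> /=.
exists q.2; last by rewrite -q1 -surjective_pairing.
by rewrite mem_filter mem_iota add1n ltnS Mq.
Qed.

Lemma sorted_seq_of_mult M : sorted ltn [seq q.2 | q <- seq_of_mult M].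
Proof.
rewrite /seq_of_mult -map_comp map_id_in //.
by apply: sorted_filter; [exact: ltn_trans|exact: iota_ltn_sorted].
Qed.

(** Two sequences strictly sorted by their parts coincide once they have the same elements. *)
Lemma seq_of_multK lam : is_partition l lam -> seq_of_mult (mult lam) = lam.
Proof.
move=> plam; have ulam := partition_uniq _ plam.
apply: (irr_sorted_eq (leT := relpre snd ltn)).
- by move=> q r t; apply: ltn_trans.
- by move=> q; apply: ltnn.
- by rewrite -sorted_map sorted_seq_of_mult.
- by rewrite -sorted_map; case/and3P: plam.
move=> q; rewrite mem_seq_of_mult; apply/and3P/idP => [[Mq ql /eqP q1]|qlam].
  have /mapP[r rlam qr] : q.2 \in [seq r.2 | r <- lam].
    by apply: contraTT Mq => /mult_notin ->.
  rewrite [q]surjective_pairing q1 qr (mult_in _ _ ulam rlam).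
  by rewrite -surjective_pairing.
rewrite (mult_in _ _ ulam qlam) eqxx (partition_part_le _ _ plam qlam).
by have /and3P[] := partition_le _ _ plam qlam.
Qed.

Lemma mult_seq_of_mult M k : (0 < k <= l)%N -> mult (seq_of_mult M) k = M k.
Proof.
move=> kl; have uM : uniq [seq q.2 | q <- seq_of_mult M].
  by apply: sorted_uniq (sorted_seq_of_mult M); [exact: ltn_trans|exact: ltnn].
case: (posnP (M k)) => Mk.
  rewrite Mk; apply: mult_notin; apply/mapP => -[q].
  by rewrite mem_seq_of_mult => /and3P[+ _ _] kq; rewrite -kq Mk.
by rewrite -[k in LHS]/(M k, k).2 mult_in // mem_seq_of_mult Mk kl eqxx.
Qed.

(* Index [0] stands for the direction beta, and index [k > 0] for the direction
   of the [k]-th derivative of [x]. *)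
Definition part_weight (k : 'I_l.+1) : nat := maxn k 1.

(** The beta directions have weight 1 and are counted among the parts equal to 1. *)
Definition total_mult mu k : nat := (mu (inord k) + (k == 1) * mu ord0)%N.

Definition partition_of mu := seq_of_mult (total_mult mu).

(** The upper bound of the inner sum, the first multiplicity times the indicator that the first part
    is 1. *)
Definition max_beta lam : nat := (first_mult lam * (first_part lam == 1))%N.

(** Moves [b] of the parts 1 to the index of beta; inverse to taking [partition_of mu] together with
    [mu ord0]. *)
Definition mu_of lam b : {ffun 'I_l.+1 -> 'I_l.+1} :=
  [ffun k : 'I_l.+1 => if k == ord0 then inord b
                       else inord (mult lam k - (k == 1 :> nat) * b)].

(** Ensures that the subtraction in [mu_of] is not truncated. *)
Lemma max_beta_le lam b : is_partition l lam -> (b <= max_beta lam)%N ->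
  (b <= mult lam 1)%N.
Proof.
rewrite /max_beta; case: lam => [|[m k] lam] plam.
  by rewrite leqn0 => /eqP->.
rewrite /first_mult /first_part /=; have [k1|_] := eqVneq k 1%N; last first.
  by rewrite muln0 leqn0 => /eqP->.
rewrite muln1 -{1}k1.
by rewrite (mult_in _ (m, k) (partition_uniq _ plam) (mem_head _ _)).
Qed.

Lemma partition_of_muK lam b : is_partition l lam -> (b <= max_beta lam)%N ->
  partition_of (mu_of lam b) = lam.
Proof.
move=> plam /(max_beta_le _ _ plam) b1.
rewrite -[RHS](seq_of_multK _ plam); apply: eq_seq_of_mult => k /andP[k0 kl].
have ml k' := partition_mult_le _ k' plam.
rewrite /total_mult !ffunE eqxx.
have -> : (inord k == ord0 :> 'I_l.+1) = false.
  by apply/eqP => /(congr1 val); rewrite /= inordK // => k00; rewrite k00 in k0.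
rewrite !inordK //; last 2 first.
- by rewrite ltnS (leq_trans b1).
- by rewrite ltnS (leq_trans (leq_subr _ _)).
by case: (eqVneq k 1%N) => [->|_]; rewrite ?mul1n ?subnK // mul0n subn0 addn0.
Qed.

Lemma mu_of_partitionK mu :
  mu_of (partition_of mu) (mu ord0) = mu.
Proof.
apply/ffunP => k; rewrite ffunE.
have [->|k0] := eqVneq k ord0; first exact: inord_val.
have k_gt0 : (0 < k)%N by rewrite lt0n.
rewrite mult_seq_of_mult; last by rewrite k_gt0 /= -ltnS ltn_ord.
rewrite /total_mult addnK.
by rewrite !inord_val.
Qed.

(** If beta occurs, then 1 is a part and, being the smallest possible, heads the partition. *)
Lemma mu0_le_max_beta mu : (mu ord0 <= max_beta (partition_of mu))%N.
Proof.
case: (posnP (mu ord0)) => [->//|mu0].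
have M1 : (0 < total_mult mu 1)%N.
  by rewrite /total_mult mul1n addn_gt0 mu0 orbT.
have E : iota 1 l = 1%N :: iota 2 l.-1 by rewrite -[in LHS](prednK l_gt0).
rewrite /max_beta /partition_of /seq_of_mult E /= M1 /=.
by rewrite /first_mult /first_part /= muln1 /total_mult mul1n leq_addl.
Qed.

Lemma weight_partition_of mu :
  (\sum_(q <- partition_of mu) q.1 * q.2)%N = weight part_weight mu.
Proof.
have := big_mult _ _ addn (fun m k => m * k)%N (partition_of mu) l.
move=> ->; first last.
- by move=> q; rewrite mem_seq_of_mult => /and3P[].
- by apply: sorted_uniq (sorted_seq_of_mult _); [exact: ltn_trans|exact: ltnn].
- by [].
under eq_bigr => k _ do rewrite mult_seq_of_mult ?ltn_ord //=.
rewrite /weight big_ord_recl /part_weight /= mul1n.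
have E (k : 'I_l) : inord k.+1 = lift ord0 k :> 'I_l.+1.
  by apply: val_inj; rewrite /= inordK // ltnS.
under eq_bigr => k _ do rewrite /total_mult E mulnDl.
rewrite big_split /= addnC; congr (_ + _)%N.
  (* Index 0 here is the part 1, the only one to receive the beta multiplicity. *)
  rewrite (bigD1 (Ordinal l_gt0)) //= big1 ?addn0 ?mul1n ?muln1 // => k k0.
  by rewrite eqSS; move: k0; rewrite -val_eqE /= => /negPf->; rewrite mul0n.
by apply: eq_bigr => k _; rewrite /bump /= add1n mulnC (maxn_idPl _).
Qed.

Lemma is_partition_of mu : weight part_weight mu = l ->
  is_partition l (partition_of mu).
Proof.
move=> wmu; apply/and3P; split; first exact: sorted_seq_of_mult.
  apply/allP => q; rewrite mem_seq_of_mult => /and3P[Mq /andP[-> _] /eqP->].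
  by rewrite Mq.
by rewrite weight_partition_of wmu.
Qed.

Lemma weight_mu_of lam b : is_partition l lam -> (b <= max_beta lam)%N ->
  weight part_weight (mu_of lam b) = l.
Proof.
move=> plam bB; rewrite -weight_partition_of partition_of_muK //.
by case/and3P: plam => _ _ /eqP.
Qed.

Lemma mu_of0 lam b : is_partition l lam -> (b <= max_beta lam)%N ->
  mu_of lam b ord0 = b :> nat.
Proof.
move=> plam bB; rewrite ffunE eqxx inordK // ltnS.
by apply: leq_trans (max_beta_le _ _ plam bB) _; exact: partition_mult_le.
Qed.

(** The sum is fibered over [partition_of mu]; within a fiber, [mu] is determined by
    [b = mu ord0]. *)
Lemma sum_partitions (R : nzRingType) (H : {ffun 'I_l.+1 -> 'I_l.+1} -> R)
    (s : seq (seq (nat * nat))) : uniq s ->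
  (forall lam, (lam \in s) = is_partition l lam) ->
  \sum_(mu | weight part_weight mu == l) H mu =
  \sum_(lam <- s) \sum_(0 <= b < (max_beta lam).+1) H (mu_of lam b).
Proof.
move=> us sP.
transitivity (\sum_(mu | weight part_weight mu == l)
    \sum_(lam <- s | lam == partition_of mu) H mu).
  apply: eq_bigr => mu /eqP wmu; rewrite -big_filter.
  by rewrite filter_pred1_uniq ?big_seq1 // sP is_partition_of.
rewrite (exchange_big_dep xpredT) //=; apply: eq_big_seq => lam.
rewrite sP => plam; rewrite big_mkord.
rewrite (reindex_onto (fun b : 'I_(max_beta lam).+1 => mu_of lam b)
                      (fun mu => inord (mu ord0))) /=; last first.
  move=> mu /andP[_ /eqP->]; rewrite inordK ?mu_of_partitionK //.
  by rewrite ltnS mu0_le_max_beta.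
apply: eq_bigl => b; have bB : (b <= max_beta lam)%N by rewrite -ltnS.
rewrite weight_mu_of // partition_of_muK // !eqxx /=.
by apply/eqP; apply: val_inj; rewrite /= mu_of0 // inordK.
Qed.

(** The parts left for x directions once [b] parts 1 are taken along beta. The first multiplicity
    may become 0, so this need not be a partition. *)
Definition drop_first lam b : seq (nat * nat) :=
  (first_mult lam - b, first_part lam)%N :: behead lam.

Lemma map_drop_first lam b : is_partition l lam ->
  [seq q.2 | q <- drop_first lam b] = [seq q.2 | q <- lam].
Proof.
case: lam => // /and3P[_ _]; rewrite big_nil => /eqP l0.
by move: l_gt0; rewrite -l0.
Qed.

Lemma mult_drop_first lam b (k : 'I_l.+1) : k != ord0 ->
  is_partition l lam -> (b <= max_beta lam)%N ->
  mult (drop_first lam b) k = mu_of lam b k.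
Proof.
move=> k0 plam bB; rewrite ffunE (negPf k0) inordK; last first.
  by rewrite ltnS (leq_trans (leq_subr _ _)) // partition_mult_le.
move: bB; rewrite /max_beta /drop_first /first_mult /first_part.
case: lam plam => [|[m q] lam] plam /=.
  rewrite muln0 leqn0 => /eqP->; rewrite muln0 subn0.
  by rewrite /mult big_cons !big_nil; case: ifP.
case: (eqVneq q 1%N) => [->|_]; last first.
  by rewrite muln0 leqn0 => /eqP->; rewrite muln0 !subn0.
rewrite muln1 /mult !big_cons /= => bm.
rewrite [1%N == _]eq_sym; case: eqP => _.
  by rewrite !mul1n addnBAC.
by rewrite !mul0n subn0.
Qed.

Lemma big_drop_first (S : Type) (idx : S) (op : Monoid.com_law idx)
    (phi : nat -> nat -> S) lam b :
  (forall k, phi 0%N k = idx) ->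
  is_partition l lam -> (b <= max_beta lam)%N ->
  \big[op/idx]_(q <- drop_first lam b) phi q.1 q.2 =
  \big[op/idx]_(k < l) phi (mu_of lam b (lift ord0 k)) k.+1.
Proof.
move=> phi0 plam bB.
have us : uniq [seq q.2 | q <- drop_first lam b].
  by rewrite map_drop_first // partition_uniq.
rewrite (big_mult _ _ _ _ _ l) //; last first.
  move=> q /(map_f snd); rewrite map_drop_first // => /mapP[r rlam ->].
  exact: partition_part_le rlam.
by apply: eq_bigr => k _; rewrite -mult_drop_first //.
Qed.

(** The coefficient has [p_1!] to the power [m_1], the multi-index to the power [m_1 - b]. They
    agree: either [p_1 = 1] and the powers are 1, or [b = 0]. *)
Lemma partition_coefE (R : realType) lam b :
  is_partition l lam -> (b <= max_beta lam)%N ->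
  partition_coef R l lam b = l`!%:R * mu_coef part_weight (mu_of lam b).
Proof.
move=> plam bB; rewrite /partition_coef /mu_coef; congr (_ / _%:R).
rewrite big_ord_recl /= mu_of0 // {1}/part_weight /= exp1n muln1.
under [in RHS]eq_bigr => k _ do
  rewrite (_ : part_weight (lift ord0 k) = k.+1) ?(maxn_idPl _) //.
rewrite -!mulnA; congr (_ * _)%N.
rewrite -(big_drop_first _ _ muln (fun m k => m`! * k`! ^ m)%N) //.
rewrite big_split /= /drop_first big_cons /= -!mulnA; congr (_ * (_ * _))%N.
rewrite big_cons /=; move: bB; rewrite /max_beta /first_mult /first_part.
case: lam plam => [|[m q] lam] _ /=; first by rewrite big_nil exp1n.
rewrite big_cons /=; case: (eqVneq q 1%N) => [->|_]; first by rewrite !exp1n.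
by rewrite muln0 leqn0 => /eqP->; rewrite subn0.
Qed.

End PartitionsAsMultiplicities.

(** * Finiteness of the partitions and the parts of non-trivial ones *)

Lemma finite_partitions l : finite_set [set lam | is_partition l lam].
Proof.
apply: (@sub_finite_set _ _
  (nontrivial_partitions l `|` [set [:: (1%N, l)]])).
  by move=> lam plam; have [->|] := pselect (lam = [:: (1%N, l)]); [right|left].
rewrite finite_setU; split; last exact: finite_set1.
exact: finite_nontrivial_partitions.
Qed.

(** A part equal to [l] exhausts the sum: its multiplicity is 1 and, all terms being positive, no
    other part remains, which is the trivial partition. *)
Lemma nontrivial_part_lt l lam q : nontrivial_partitions l lam ->
  q \in lam -> (0 < q.2 < l)%N.
Proof.
move=> [plam ntlam] qlam.
have /andP[-> le_l] /= := partition_part_le _ _ _ plam qlam.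
rewrite ltn_neqAle le_l andbT; apply/eqP => ql; apply: ntlam.
have l_gt0 : (0 < l)%N.
  by rewrite -ql; case/andP: (partition_part_le _ _ _ plam qlam).
case/splitPr: qlam plam => s t plam; case/and3P: (plam) => _ /allP pos /eqP.
have {}pos r : r \in s ++ q :: t -> (0 < r.1 * r.2)%N.
  by move=> /pos /=; rewrite muln_gt0.
rewrite big_cat big_cons /= => E.
have q1 : q.1 = 1%N.
  apply/eqP; rewrite eqn_leq -(leq_pmul2r l_gt0) mul1n; apply/andP; split.
    by rewrite -[X in (_ <= X)%N]E ql addnCA leq_addr.
  have := pos q; rewrite mem_cat mem_head orbT ql muln_gt0.
  by case/(_ isT)/andP.
move: E; rewrite q1 ql mul1n addnCA -[RHS]addn0 => /addnI/eqP.
rewrite addn_eq0 => /andP[s0 t0].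
have nil0 u : \sum_(r <- u) r.1 * r.2 == 0%N ->
    {subset u <= s ++ q :: t} -> u = [::].
  case: u => // r u; rewrite big_cons addn_eq0 => /andP[+ _] ru.
  by rewrite eqn0Ngt pos // ru ?mem_head.
rewrite (nil0 s s0) => [|r rs]; last by rewrite mem_cat rs.
rewrite (nil0 t t0) => [|r rt]; last by rewrite mem_cat in_cons rt !orbT.
by rewrite [q]surjective_pairing q1 ql.
Qed.

Lemma eq_partition_args (V : Type) (xd xk : nat -> V) lam b :
  {in lam, forall q, xd q.2 = xk q.2} ->
  partition_args xd lam b = partition_args xk lam b.
Proof.
case: lam => [|q lam] //= E.
rewrite /partition_args /first_part /= E ?mem_head //.
congr (_ ++ flatten _); apply/eq_in_map => r rlam.
by rewrite E // in_cons rlam orbT.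
Qed.

(** * Differentiating the root equation [l] times *)

Section ImplicitDerivatives.
Context {R : realType} {T l : nat}.
Hypothesis l_gt0 : (0 < l)%N.

Definition curve_direction (xk : nat -> 'rV[R]_T) (k : 'I_l.+1) :=
  if k == ord0 then beta_direction else x_direction (xk k).

(** The tensor lists the beta directions last, the multi-index first; comparing counts suffices. *)
Lemma perm_partition_args xk lam b :
  is_partition l lam -> (b <= max_beta lam)%N ->
  perm_eq (map x_direction (partition_args xk lam b) ++ nseq b beta_direction)
          (mu_args (curve_direction xk) (mu_of l lam b)).
Proof.
move=> plam bB; apply/permP => a; rewrite count_mu_args big_ord_recl mu_of0 //.
rewrite count_cat count_nseq addnC mulnC; congr (_ + _)%N.
rewrite count_map -[partition_args _ _ _]/(flatten
  [seq nseq q.1 (xk q.2) | q <- drop_first lam b]).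
rewrite count_flatten -map_comp sumnE big_map /=.
under eq_bigr => q _ do rewrite count_nseq mulnC.
rewrite (big_drop_first _ l_gt0 _ _ addn
  (fun m k => m * (a \o x_direction) (xk k))%N) //.
Qed.

Variables (F : 'rV[R]_T * R -> 'rV[R]_T) (x : R -> 'rV[R]_T) (beta0 : R).
Hypothesis F_diff : times_differentiable l F.
Variable U : set R.
Hypotheses (oU : open U) (Ubeta0 : U beta0).
Hypothesis x_diff : times_derivable_on U l x.

Local Notation xk := (fun k => derive1n k x beta0).

Lemma derive1n_comp_curve (f : 'rV[R]_T * R -> R) :
  times_differentiable l f ->
  derive1n l (fun t => f (x t, t)) beta0 =
  l`!%:R *
  \sum_(mu : {ffun 'I_l.+1 -> 'I_l.+1} | weight (part_weight l) mu == l)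
    mu_coef (part_weight l) mu *
    iter_derive (mu_args (curve_direction xk) mu) f (x beta0, beta0).
Proof.
move=> df.
have fact0 n : n`!%:R != 0 :> R by rewrite pnatr_eq0 -lt0n fact_gt0.
pose b n (g : 'rV[R]_T * R -> R) :=
  derive1n n (fun t => g (x t, t)) beta0 / n`!%:R.
rewrite -(bell_expansion (part_weight l) (curve_direction xk) _
  (x beta0, beta0) b) //.
- by rewrite /b mulrCA divff ?mulr1.
- by move=> k; rewrite /part_weight leq_max orbT.
- by move=> g; rewrite /b divr1.
move=> n g nl dg.
have [_ /(_ n erefl beta0 Ubeta0) E] :=
  derive1n_curve oU x _ g (times_derivable_onW _ _ _ nl x_diff) dg.
rewrite big_mkcond big_ord_recl /= /part_weight /= {1}/curve_direction eqxx.
rewrite /b E factS natrM invfM [X in _ * X = _]mulrCA mulVKf ?pnatr_eq0 //.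
rewrite max0n subn1 /= divr1 mul1r mulrDl addrC; congr (_ + _).
rewrite (big_ord_widen l (fun k => 'C(n, k)%:R *
   derive1n (n - k) (fun t => 'D_(x_direction (xk k.+1)) g (x t, t)) beta0)) //.
rewrite mulr_suml big_mkcond /=; apply: eq_bigr => k _.
rewrite /curve_direction /= /bump add1n (maxn_idPl _) // ltnS.
case: ifP => [kn|]; last by [].
rewrite subSS.
(* After division by [n!] the binomial leaves [1 / k!], which is [p / p!] for the part [p = k.+1],
   as the recursion demands. *)
have -> : 'C(n, k)%:R = n`!%:R / (k`!%:R * (n - k)`!%:R) :> R.
  by rewrite -(bin_fact kn) !natrM mulfK // mulf_neq0.
rewrite factS natrM.
set D := derive1n _ _ _.
field.
by rewrite !fact0 nat1r pnatr_eq0.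
Qed.

(** Each coordinate is the [l]-th derivative of a coordinate of [F] along the curve, where it
    vanishes identically near [beta0]. The trivial partition is still included. *)
Lemma sum_partitions_tensor :
  (forall t, U t -> F (x t, t) = 0) ->
  \sum_(lam \in [set lam | is_partition l lam])
    \sum_(0 <= b < (max_beta lam).+1)
      partition_coef R l lam b *:
      derivative_tensor F b (partition_args xk lam b) (x beta0, beta0) = 0.
Proof.
move=> F0.
have finP := finite_partitions l.
apply/rowP => i; rewrite mxE fsbig_finite // summxE.
have dFi := times_differentiable_coord _ _ _ i F_diff.
have E : derive1n l (fun t => F (x t, t) 0 i) beta0 = 0.
  rewrite (eq_derive1n_on oU l _ (fun=> 0)) //; last first.
    by move=> t Ut; rewrite F0 ?mxE.
  elim: {+}l => [//|n IH]; rewrite derive1Sn.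
  rewrite (_ : (fun=> 0)^`() = fun=> 0) //.
  by apply/funext => t; rewrite derive1_cst.
rewrite -[RHS]E (derive1n_comp_curve (fun p => F p 0 i) dFi).
rewrite (sum_partitions l l_gt0 _ _
  (finmap.enum_fset (fset_set [set lam | is_partition l lam]))).
- rewrite mulr_sumr; apply: eq_big_seq => lam.
  rewrite in_fset_set // inE /= => plam.
  rewrite summxE mulr_sumr; apply: eq_big_nat => b /andP[_].
  rewrite ltnS => bB; have pa := perm_partition_args xk _ _ plam bB.
  (* Each direction has weight at least 1, so at most [l] of them occur and [F_diff] provides enough
     derivatives. *)
  have sl : (size (map x_direction (partition_args xk lam b) ++
      nseq b (beta_direction : 'rV[R]_T * R)) <= l)%N.
    rewrite (perm_size pa) -[X in (_ <= X)%N](weight_mu_of _ l_gt0 _ _ plam bB).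
    by apply: size_mu_args => k; rewrite /part_weight leq_max orbT.
  rewrite mxE derivative_tensorE; last first.
    apply: times_differentiableW F_diff.
    by move: sl; rewrite size_cat size_map size_nseq.
  rewrite partition_coefE // mulrA; congr (_ * _).
  by rewrite (perm_iter_derive _ _ _ pa) //; apply: times_differentiableW dFi.
- exact: finmap.fset_uniq.
by move=> lam; rewrite in_fset_set //; apply/idP/idP; rewrite inE.
Qed.

End ImplicitDerivatives.

(** * Solving for the derivative of order [l] *)

Theorem theorem3 (R : realType) (T l : nat)
    (F : 'rV[R]_T * R -> 'rV[R]_T) (x : R -> 'rV[R]_T) (beta0 : R)
    (l_gt0 : (0 < l)%N)
    (F_diff : times_differentiable l F)
    (x_diff : \forall beta \near beta0,
       forall k : nat, (k < l)%N -> derivable (x^`(k)) beta 1)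
    (x_root : \forall beta \near beta0, F (x beta, beta) = 0) :
  ((1 < l)%N ->
   forall xd : nat -> 'rV[R]_T,
   (forall k : nat, (0 < k < l)%N -> xd k = x^`(k) beta0) ->
   derivative_tensor F 0 [:: x^`(l) beta0] (x beta0, beta0) =
   - \sum_(lam \in nontrivial_partitions l)
       \sum_(0 <= b < (first_mult lam * (first_part lam == 1%N)).+1)
         partition_coef R l lam b *:
         derivative_tensor F b (partition_args xd lam b) (x beta0, beta0))
  /\
  (l = 1%N ->
   derivative_tensor F 0 [:: x^`() beta0] (x beta0, beta0) =
   - derivative_tensor F 1 [::] (x beta0, beta0)).
Proof.
have : nbhs beta0 (fun t => (forall k, (k < l)%N -> derivable (x^`(k)) t 1) /\
    F (x t, t) = 0).
  by apply: filterI.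
rewrite nbhsE => -[U [oU U0] HU].
have xU : times_derivable_on U l x by move=> t /HU[].
have FU t : U t -> F (x t, t) = 0 by move=> /HU[].
split=> [l1 xd xdE|l1]; last first.
  move: F_diff xU; rewrite l1 => dF dx; apply/eqP; rewrite -addr_eq0.
  apply/eqP/rowP => i; rewrite [LHS]mxE [RHS]mxE.
  rewrite !derivative_tensorE //=.
  (* For [l = 1] the first-order chain rule already consists of just the two terms wanted. *)
  have [_ /(_ 0%N erefl beta0 U0)] := derive1n_curve oU x _ _ dx
    (times_differentiable_coord _ _ _ i dF).
  rewrite (eq_derive1n_on oU _ _ (fun=> 0)) //; last first.
    by move=> t /FU ->; rewrite mxE.
  by rewrite derive1n1 derive1_cst big_ord1 bin0 mul1r.
have := sum_partitions_tensor l_gt0 F x beta0 F_diff U oU U0 xU FU.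
have triv : is_partition l [:: (1%N, l)].
  by rewrite /is_partition /= l_gt0 big_seq1 mul1n eqxx.
rewrite (fsbigD1 [:: (1%N, l)]) //; last exact: finite_partitions.
(* Since [1 < l], the trivial partition has no part 1, so only [b = 0] occurs, with coefficient
   [l! / l! = 1]. *)
rewrite /max_beta /first_part /first_mult /= (gtn_eqF l1) big_nat1.
rewrite /partition_coef big_nil big_seq1 /= !mul1n expn1 divff; last first.
  by rewrite pnatr_eq0 -lt0n fact_gt0.
rewrite scale1r => /eqP; rewrite addr_eq0 => /eqP ->; congr (- _).
apply: eq_fsbigr => lam; rewrite inE => ntlam; apply: eq_bigr => b _.
(* All parts of a non-trivial partition lie strictly between 0 and [l], where [xd] agrees with the
   derivatives of [x]. *)
rewrite (eq_partition_args _ xd (fun k => derive1n k x beta0)) // => q qlam.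
rewrite xdE //.
exact: nontrivial_part_lt qlam.
Qed.
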